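(* Let $a>0$ be a fixed real number. Let $(k_n,n\ge1)$ be a sequence of integers with $1\le k_n\le n$ for all $n$ and $\lim_{n\to\infty}k_n/n=1$, and let $\mathbb{X}=(X_n,n\ge 1)$ be a strictly stationary sequence of random variables on a probability space $(\Omega,\mathcal{F},\mathbb{P})$ such that $\gamma_1(X_1|\mathcal{I}^{\mathbb{X}})=\infty$ almost surely. Then $$\frac{S(k_n,n,a)}{n\,X_{k_n:n}}\longrightarrow0\quad\text{almost surely as }n\to\infty.$$ If moreover $(N(t),t\ge0)$ is a process of non-negative integer-valued random variables on $(\Omega,\mathcal{F},\mathbb{P})$, $Z$ is an almost surely positive random variable on $(\Omega,\mathcal{F},\mathbb{P})$, $c(\cdot)$ is a positive function with $c(t)\to\infty$ as $t\to\infty$, and $N(t)/c(t)\to Z$ almost surely as $t\to\infty$, then $$\frac{\mathcal{S}_t(k_{N(t)},a)}{c(t)\,X_{k_{N(t)}:N(t)}}\longrightarrow0\quad\text{almost surely as }t\to\infty.$$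
   Context: $\mathcal{I}^{\mathbb{X}}$ is the sigma-field of sets invariant with respect to $\mathbb{X}$, i.e. of all $A\subseteq\Omega$ for which there is a Borel set $B\in\mathcal{B}(\mathbb{R}^{\mathbb{N}})$ with $A=\{\omega\in\Omega:(X_i(\omega),X_{i+1}(\omega),\ldots)\in B\}$ for every $i\ge1$. An extended random variable is a measurable function with values in $[-\infty,\infty]$. For a (real-valued) random variable $X$ on $(\Omega,\mathcal{F},\mathbb{P})$ and a sigma-field $\mathcal{G}\subseteq\mathcal{F}$, the conditional right endpoint of the support of $X$ given $\mathcal{G}$, denoted $\gamma_1(X|\mathcal{G})$, is an extended random variable $\underline{Q}_1$ such that (i) $\underline{Q}_1$ is $\mathcal{G}$-measurable; (ii) $\mathbb{P}(X\le\underline{Q}_1|\mathcal{G})=1$ a.s.; (iii) for any $\mathcal{G}$-measurable extended random variable $Q_1$ with $\mathbb{P}(X\le Q_1|\mathcal{G})=1$ a.s., one has $Q_1\ge\underline{Q}_1$ a.s. It exists and is unique up to almost sure equality. $X_{1:n}\le\cdots\le X_{n:n}$ are the order statistics of $X_1,\ldots,X_n$; $I(\cdot)$ is the indicator function. Define $S(k_n,n,a)=\sum_{i=1}^n X_i\, I(X_{k_n:n}-a<X_i<X_{k_n:n})$ and $\mathcal{S}_t(k_{N(t)},a)=\sum_{i=1}^{N(t)} X_i\, I(X_{k_{N(t)}:N(t)}-a<X_i<X_{k_{N(t)}:N(t)})$, with empty sums equal to $0$. The quotients are assigned the value $0$ when undefined (zero denominator or $N(t)=0$). *)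

(* Defs.v *)
From HB Require Import structures.
From mathcomp Require Export all_boot all_order all_algebra.
From mathcomp Require Export all_classical all_reals all_analysis.
From mathcomp Require Export measurable_realfun.

Set Implicit Arguments.
Unset Strict Implicit.
Unset Printing Implicit Defensive.

Export Order.TTheory GRing.Theory Num.Theory.
Export numFieldNormedType.Exports.

Local Open Scope classical_set_scope.
Local Open Scope ring_scope.

(* Sequences (X_n, n >= 1) are indexed from 0 throughout: X i is X_{i+1}. *)

(* B(R^N): the sigma-algebra generated by the open sets of the product
   topology. *)
Definition borel_RN (R : realType) : set (set (nat -> R)) :=
  <<s [set U : set {ptws nat -> R} | open U] >>.

Definition strictly_stationary (d : measure_display) (T : measurableType d)
    (R : realType) (P : probability T R) (X : nat -> {RV P >-> R}) : Prop :=
  forall (n h : nat) (B : set (n.-tuple R)), measurable B ->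
    P [set w | B [tuple X (h + i)%N w | i < n]] =
    P [set w | B [tuple X i w | i < n]].

Definition invariant_sigma_field (T : Type) (R : realType)
    (X : nat -> T -> R) : set (set T) :=
  [set A | exists2 B : set (nat -> R), borel_RN B &
    forall i : nat, A = [set w | B (fun j : nat => X (i + j)%N w)]].

(* In what follows G is meant to be a sub-sigma-field of the measurable sets
   of T. *)

Definition measurable_wrt (T : Type) (G : set (set T)) (d' : measure_display)
    (U : measurableType d') (f : T -> U) : Prop :=
  forall B : set U, measurable B -> G (f @^-1` B).

Definition cond_probability_version (d : measure_display)
    (T : measurableType d) (R : realType) (P : probability T R)
    (G : set (set T)) (E : set T) (Y : T -> R) : Prop :=
  [/\ measurable_wrt G Y,
      P.-integrable setT (EFin \o Y) &
      forall A : set T, G A ->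
        (\int[P]_(w in A) (Y w)%:E)%E = P (A `&` E)].

(* P(E | G) = 1 a.s. *)
Definition cond_probability_eq1 (d : measure_display)
    (T : measurableType d) (R : realType) (P : probability T R)
    (G : set (set T)) (E : set T) : Prop :=
  exists2 Y : T -> R, cond_probability_version P G E Y &
    {ae P, forall w, Y w = 1}.

(* Q is (a version of) gamma_1(X | G). *)
Definition is_cond_right_endpoint (d : measure_display)
    (T : measurableType d) (R : realType) (P : probability T R)
    (X : T -> R) (G : set (set T)) (Q : T -> \bar R) : Prop :=
  [/\ measurable_wrt G Q,
      cond_probability_eq1 P G [set w | ((X w)%:E <= Q w)%E] &
      forall Q1 : T -> \bar R, measurable_wrt G Q1 ->
        cond_probability_eq1 P G [set w | ((X w)%:E <= Q1 w)%E] ->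
        {ae P, forall w, (Q w <= Q1 w)%E}].

(* x_{k:n}, the k-th smallest (1 <= k <= n) of the first n terms of x. *)
Definition order_stat (R : realType) (x : nat -> R) (k n : nat) : R :=
  nth 0 (sort <=%R [seq x i | i <- iota 0 n]) k.-1.

(* S(k, n, a) for the sequence of values x. *)
Definition near_sum (R : realType) (x : nat -> R) (k n : nat) (a : R) : R :=
  \sum_(i < n | order_stat x k n - a < x i < order_stat x k n) x i.

(* Main.v *)
From HB Require Import structures.
Require Import Defs.
From mathcomp Require Import lra ring zify.

(** Once the order statistic q = X_{k_n:n} exceeds m + a, where m >= 0, every
    term of the sum S(k_n, n, a) lies between m and q, so that
      0 <= S(k_n, n, a) / (n q) <= #{i <= n : X_i > m} / n
    ([near_sum_bound]).  The convergence therefore follows, path by path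
    ([near_sum_cvg0]), from two almost sure facts on frequencies of
    exceedances:
    - every level M is exceeded with positive lower frequency
      ([ae_exceeds_often]); as n - k_n = o(n), this pushes X_{k_n:n} above M
      ([order_stat_cvgy]);
    - the upper frequency of exceedances of m tends to 0 as m grows
      ([ae_exceeds_rarely]).

    Birkhoff's ergodic theorem would give both, but only an inequality is
    needed ([visits_covering]): if theta preserves P, E is invariant, and every
    point of E has some n > 0 with at most c n visits to F before time n, then
    P(E & F) <= c P(E).  Applied to the shift on the space of sequences and to
    the event E that M is exceeded with zero lower frequency, it shows that
    X_1 <= M almost surely on E.  Since E is invariant, the extended random
    variable equal to M on E and to +oo elsewhere competes with the conditional
    right endpoint of X_1, which is infinite; hence P(E) = 0.  Applied to the
    complements of F_m = {X_1 > m}, it shows that the event on which, for all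
    m, the levels m are exceeded with upper frequency bounded away from 0 has
    probability at most a constant times P(F_m), for every m, hence 0.

    In place of lower frequencies, which are awkward to handle under the shift,
    the proof uses the condition sup_n (c n - #visits before n) = +oo
    ([unbounded_deficit]): it is invariant because a shift changes the
    expression under the supremum by a bounded amount.

    For a random index, S / (c(t) X) = (N(t) / c(t)) * (S / (N(t) X)), where
    N(t) tends to infinity because Z > 0 and c(t) tends to infinity. *)

Set Implicit Arguments.
Unset Strict Implicit.
Unset Printing Implicit Defensive.

Local Open Scope classical_set_scope.
Local Open Scope ring_scope.

(** * Time averages along a measure-preserving map *)

(** Cut {0, ..., N-1} greedily from the left.  From a position i that is not
    bad (b i < 1) take a block of length n <= L on which the average of f is at
    most c; from a bad position take the single i, where f i <= 1 <= b i.  The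
    last block may overrun N, and this costs at most L. *)
Lemma sum_covering (R : realFieldType) (c : R) (L N : nat) (f b : nat -> R) :
  0 <= c -> (forall i, 0 <= f i <= 1) -> (forall i, 0 <= b i) ->
  (forall i, 1 <= b i \/ exists n, [/\ (0 < n)%N, (n <= L)%N &
     \sum_(j < n) f (i + j)%N <= c * n%:R]) ->
  \sum_(i < N) f i <= c * N%:R + \sum_(i < N) b i + L%:R.
Proof.
move=> c0; have [M] := ubnP N; elim: M N f b => // M IH N f b NM f01 b0 cover.
have sb0 m : 0 <= \sum_(j < m) b j by apply: sumr_ge0.
have step n : (0 < n <= N)%N ->
    \sum_(j < n) f j <= c * n%:R + \sum_(j < n) b j ->
    \sum_(i < N) f i <= c * N%:R + \sum_(i < N) b i + L%:R.
  move=> /andP[n0 nN] fn; rewrite -(subnKC nN) !big_split_ord /= natrD.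
  have := IH (N - n)%N (fun j => f (n + j)%N) (fun j => b (n + j)%N).
  move=> /(_ ltac:(lia)) H.
  have {}H : \sum_(i < N - n) f (n + i)%N <=
    c * (N - n)%:R + \sum_(i < N - n) b (n + i)%N + L%:R.
    apply: H => // i; have [?|[m [? ? fm]]] := cover (n + i)%N; first by left.
    right; exists m; split=> //; apply: le_trans fm.
    by rewrite le_eqVlt; apply/orP; left; apply/eqP/eq_bigr => j _; rewrite addnA.
  by rewrite mulrDr; lra.
have [N0|N0] := posnP N.
  by rewrite N0 !big_ord0 mulr0 !add0r ler0n.
case: (cover 0%N) => [b1|[n [n0 nL fn]]].
  apply: (step 1%N); first by rewrite N0.
  by rewrite !big_ord1 mulr1; have /andP[_ ?] := f01 0%N; lra.
have [nN|Nn] := leqP n N.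
  apply: (step n); first by rewrite n0.
  by apply: (le_trans fn); rewrite lerDl.
have : \sum_(i < N) f i <= N%:R.
  rewrite -[N in X in _ <= X]card_ord -sumr_const; apply: ler_sum => i _.
  by have /andP[_ ?] := f01 i.
have : N%:R <= L%:R :> R by rewrite ler_nat; lia.
have := mulr_ge0 c0 (ler0n R N); have := sb0 N; lra.
Qed.

(** The error is made small by first choosing L, which controls r L, and only
    then N, after which L / N is negligible. *)
Lemma le_of_averages (R : realType) (p q : R) (r : nat -> R) :
  (forall L N, p * N%:R <= q * N%:R + r L * N%:R + L%:R) ->
  r L @[L --> \oo] --> 0 -> p <= q.
Proof.
move=> pq r0; apply/ler_addgt0Pr => e e0.
have e20 : 0 < e / 2 by rewrite divr_gt0.
have [L Le] : exists L, r L < e / 2.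
  have /cvgrPdist_lt/(_ _ e20)[L _ /(_ L (leqnn L))] := r0.
  by rewrite sub0r normrN => /(le_lt_trans (ler_norm _)) H; exists L.
have [N LN] : exists N : nat, L%:R < e / 2 * N.+1%:R.
  exists (Num.bound (L%:R / (e / 2))); rewrite -ltr_pdivrMl// mulrC.
  apply: (lt_le_trans (archi_boundP _)); first by rewrite divr_ge0// ltW.
  by rewrite ler_nat.
have N0 : 0 < N.+1%:R :> R by exact: ltr0Sn.
rewrite -(ler_pM2r N0); apply: (le_trans (pq L N.+1)).
have : r L * N.+1%:R <= e / 2 * N.+1%:R by rewrite ler_pM2r// ltW.
move: (N.+1%:R) LN => x LN; lra.
Qed.

Definition visits (T : Type) (R : realType) (theta : T -> T) (F : set T)
   (n : nat) (x : T) : R := \sum_(i < n) \1_F (iter i theta x).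

Section measure_preserving.
Context d (T : measurableType d) (R : realType) (P : probability T R).
Variable theta : T -> T.
Hypothesis mtheta : measurable_fun setT theta.
Hypothesis preserving : forall A, measurable A -> P (theta @^-1` A) = P A.
Implicit Types E F A : set T.

Lemma measurable_iter n : measurable_fun setT (iter n theta).
Proof.
elim: n => [|n IH]; first exact: measurable_id.
exact: (measurableT_comp mtheta IH).
Qed.

Lemma measurable_iter_preimage n A :
  measurable A -> measurable (iter n theta @^-1` A).
Proof. by move=> mA; rewrite -[X in measurable X]setTI; exact: measurable_iter. Qed.

Lemma iter_preserving n A : measurable A -> P (iter n theta @^-1` A) = P A.
Proof.
elim: n => // n IH mA; rewrite -[RHS]IH// -[RHS]preserving; last first.
  exact: measurable_iter_preimage.
by congr (P _); apply/seteqP; split => x; rewrite /preimage /= -iterS iterSr.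
Qed.

Lemma iter_invariant E n : theta @^-1` E = E -> iter n theta @^-1` E = E.
Proof.
move=> EE; elim: n => // n IH; rewrite -[RHS]IH -[in RHS]EE.
by apply/seteqP; split.
Qed.

Lemma visits_ge0 F n x : 0 <= visits R theta F n x.
Proof. exact: sumr_ge0. Qed.

Lemma measurable_indic_iter F i :
  measurable F -> measurable_fun setT (fun x => \1_F (iter i theta x) : R).
Proof.
move=> mF; apply: measurableT_comp; last exact: measurable_iter.
exact: measurable_indic.
Qed.

Lemma measurable_visits F n :
  measurable F -> measurable_fun setT (visits R theta F n).
Proof.
by move=> mF; apply: measurable_sum => i; exact: measurable_indic_iter.
Qed.

Lemma integral_visits F n : measurable F ->
  (\int[P]_x (visits R theta F n x)%:E = P F * n%:R%:E)%E.
Proof.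
move=> mF; rewrite /visits; under eq_integral do rewrite -sumEFin.
rewrite (@ge0_integral_sum _ _ _ P _ _ _
  (fun (i : 'I_n) x => (\1_F (iter i theta x))%:E))//; last first.
  by move=> i; apply/measurable_EFinP; exact: measurable_indic_iter.
have -> : P F = (fine (P F))%:E by rewrite fineK// fin_num_measure.
rewrite (eq_bigr (fun=> (fine (P F))%:E)) => [|i _].
  by rewrite sumEFin sumr_const card_ord -EFinM mulr_natr.
rewrite fineK ?fin_num_measure// -(iter_preserving i mF).
transitivity (\int[P]_x (\1_(iter i theta @^-1` F) x)%:E)%E; first by [].
by rewrite integral_indic ?setIT//; exact: measurable_iter_preimage.
Qed.

(** The maximal ergodic inequality, in the covering form of Kamae and of
    Katznelson and Weiss.  Call bad the points of E that have to wait more than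
    L for a block of low frequency.  [sum_covering] along the orbit bounds the
    visits before N pointwise.  Integrating, since theta preserves P, gives
    N P(E & F) <= c N P(E) + N P(bad) + L, and P(bad) tends to 0 with L. *)
Lemma visits_covering E F (c : R) :
  measurable F -> measurable E -> theta @^-1` E = E -> 0 <= c ->
  (forall x, E x -> exists2 n, (0 < n)%N & visits R theta F n x <= c * n%:R) ->
  (P (E `&` F) <= c%:E * P E)%E.
Proof.
move=> mF mE tE c0 Ec.
have mEF : measurable (E `&` F) by exact: measurableI.
pose good L := \bigcup_(n in [set n | (0 < n <= L)%N])
   [set x | visits R theta F n x <= c * n%:R].
have mgood L : measurable (good L).
  apply: bigcup_measurable => n _; rewrite -[X in measurable X]setTI.
  by apply: measurable_fun_le => //; exact: measurable_visits.
pose bad L := E `\` good L.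
have mbad L : measurable (bad L) by exact: measurableD.
have bad0 : P (bad L) @[L --> \oo] --> 0%E.
  have -> : 0%E = P (\bigcap_L bad L).
    rewrite -[LHS](measure0 P); congr (P _); apply/esym/seteqP; split=> // x bx.
    have [n n0 nx] := Ec x (bx 0%N I).1.
    by apply: (bx n I).2; exists n => //=; rewrite n0 leqnn.
  apply: nonincreasing_cvg_mu => //.
  - exact: le_lt_trans (probability_le1 _ _) (ltry _).
  - exact: bigcap_measurable.
  - move=> L L' LL'; apply/subsetPset => x [Ex nx]; split=> // -[n /= nL gn].
    by apply: nx; exists n => //=; case/andP: nL => -> /leq_trans; apply.
have pointwise L N x : visits R theta (E `&` F) N x
    <= c * N%:R * \1_E x + visits R theta (bad L) N x + L%:R.
  have iE i : E (iter i theta x) <-> E x.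
    by rewrite -[X in _ <-> X x](iter_invariant i tE).
  have [Ex|nEx] := pselect (E x); last first.
    rewrite {1}/visits big1 ?addr_ge0 ?mulr_ge0 ?visits_ge0// => i _.
    by rewrite indicE memNset// => -[/iE].
  rewrite indicE mem_set// mulr1; apply: (@sum_covering _ c L N
    (fun i => \1_(E `&` F) (iter i theta x))
    (fun i => \1_(bad L) (iter i theta x))) => //.
    by move=> i; rewrite indicE; case: (_ \in _); rewrite lexx ler01.
  move=> i; have [gi|bi] := pselect (good L (iter i theta x)); last first.
    by left; rewrite indicE mem_set//; split=> //; apply/iE.
  right; case: gi => n /= /andP[n0 nL] vn; exists n; split=> //.
  apply: le_trans vn; apply: ler_sum => j _; rewrite addnC iterD !indicE ler_nat.
  by case: (boolP (_ \in E `&` F)) => // /set_mem[_ Fx]; rewrite mem_set.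
pose pF := fine (P (E `&` F)); pose pE := fine (P E); pose pb L := fine (P (bad L)).
have fE A : measurable A -> P A = (fine (P A))%:E.
  by move=> mA; rewrite fineK// fin_num_measure.
have mean L N : pF * N%:R <= c * N%:R * pE + pb L * N%:R + L%:R.
  have mc : measurable_fun setT (fun x => c * N%:R * \1_E x).
    by apply: measurable_funM => //; exact: measurable_indic.
  have cE : (\int[P]_x (c * N%:R * \1_E x)%:E = (c * N%:R * pE)%:E)%E.
    under eq_integral do rewrite EFinM.
    rewrite ge0_integralZl_EFin ?mulr_ge0//; last first.
      by apply/measurable_EFinP; exact: measurable_indic.
    by rewrite integral_indic// setIT /pE [in RHS]EFinM fineK// fin_num_measure.
  have mvb : measurable_fun setT (EFin \o visits R theta (bad L) N).
    by apply/measurable_EFinP; exact: measurable_visits.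
  have mvF : measurable_fun setT (EFin \o visits R theta (E `&` F) N).
    by apply/measurable_EFinP; exact: measurable_visits.
  have c0E x : (0 <= (c * N%:R * \1_E x)%:E)%E by rewrite lee_fin !mulr_ge0.
  have v0 A x : (0 <= (visits R theta A N x)%:E)%E by rewrite lee_fin visits_ge0.
  rewrite -lee_fin !EFinD -cE 2!EFinM -!fE// -!integral_visits//.
  have -> : L%:R%:E = (\int[P]_x (L%:R : R)%:E)%E.
    by rewrite integral_cst// [X in (_ * X)%E](probability_setT P) mule1.
  have msum : measurable_fun setT
      (fun x => (c * N%:R * \1_E x)%:E + (visits R theta (bad L) N x)%:E)%E.
    by apply: emeasurable_funD => //; apply/measurable_EFinP.
  rewrite -!ge0_integralD//; [| by move=> x _; exact: adde_ge0| exact/measurable_EFinP].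
  apply: ge0_le_integral => //; first exact: emeasurable_funD.
  by move=> x _; rewrite -!EFinD lee_fin.
rewrite (fE _ mEF) (fE _ mE).
rewrite -EFinM lee_fin -/pF -/pE; apply: (@le_of_averages _ _ _ pb).
  by move=> L N; rewrite mulrAC; exact: mean.
exact: fine_cvg.
Qed.

End measure_preserving.

(** For c > 0 this set lies between {liminf visits / n < c} and
    {liminf visits / n <= c}; it stands in for a bound on the lower frequency
    because its invariance is elementary. *)
Definition unbounded_deficit (T : Type) (R : realType) (theta : T -> T)
    (F : set T) (c : R) : set T :=
  [set x | forall K : nat, exists n, visits R theta F n x + K%:R <= c * n%:R].

Lemma visitsS (T : Type) (R : realType) (theta : T -> T) (F : set T) n x :
  visits R theta F n.+1 x = \1_F x + visits R theta F n (theta x).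
Proof.
rewrite /visits big_ord_recl/=; congr (_ + _).
by apply: eq_bigr => i _; rewrite -iterS iterSr.
Qed.

Lemma unbounded_deficit_invariant (T : Type) (R : realType) (theta : T -> T)
    (F : set T) (c : R) : 0 <= c ->
  theta @^-1` unbounded_deficit theta F c = unbounded_deficit theta F c.
Proof.
move=> c0.
have F01 x : 0 <= (\1_F x : R) <= 1.
  by rewrite indicE; case: (_ \in _); rewrite lexx ler01.
apply/seteqP; split => x Dx K.
  have [n] := Dx K.+1; rewrite -natr1 => Dn; exists n.+1.
  rewrite visitsS -natr1; have := F01 x; nra.
have cb : c < (Num.bound c)%:R by exact: archi_boundP.
have [[|n]] := Dx (K + Num.bound c).+1.
  by rewrite mulr0 /visits big_ord0 add0r lern0.
rewrite visitsS -!natr1 natrD mulrDr mulr1 => Dn; exists n.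
have := F01 x; lra.
Qed.

Section deficit.
Context d (T : measurableType d) (R : realType) (P : probability T R).
Variable theta : T -> T.
Hypothesis mtheta : measurable_fun setT theta.
Hypothesis preserving : forall A, measurable A -> P (theta @^-1` A) = P A.

Lemma measurable_unbounded_deficit (F : set T) (c : R) :
  measurable F -> measurable (unbounded_deficit theta F c).
Proof.
move=> mF; rewrite (_ : unbounded_deficit _ _ _ = \bigcap_K \bigcup_n
    [set x | visits R theta F n x + K%:R <= c * n%:R]).
  apply: bigcapT_measurable => K; apply: bigcupT_measurable => n.
  rewrite -[X in measurable X]setTI; apply: measurable_fun_le => //.
  by apply: measurable_funD => //; exact: measurable_visits.
apply/seteqP; split => x Dx K.
  by move=> _; have [n ?] := Dx K; exists n.
by have [n _ ?] := Dx K I; exists n.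
Qed.

(** A deficit of at least 1 forces the witness n to be positive. *)
Lemma unbounded_deficit_covering (E F : set T) (c : R) :
  measurable F -> measurable E -> theta @^-1` E = E -> 0 <= c ->
  E `<=` unbounded_deficit theta F c -> (P (E `&` F) <= c%:E * P E)%E.
Proof.
move=> mF mE tE c0 ED; apply: (visits_covering mtheta) => // x /ED/(_ 1%N)[n].
case: n => [|n xn]; first by rewrite mulr0 /visits big_ord0 add0r ler10.
by exists n.+1 => //; apply: le_trans xn; rewrite lerDl.
Qed.

(** The points that visit F with lower frequency 0. *)
Definition rare_visits (F : set T) : set T :=
  \bigcap_j unbounded_deficit theta F (j.+1%:R^-1 : R).

(** The covering inequality bounds the left-hand side by 1 / (j + 1) for every
    j. *)
Lemma rare_visits_null (F : set T) :
  measurable F -> P (rare_visits F `&` F) = 0%E.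
Proof.
move=> mF; have mE : measurable (rare_visits F).
  by apply: bigcapT_measurable => j; exact: measurable_unbounded_deficit.
apply/eqP; rewrite eq_le measure_ge0 andbT.
apply/lee_addgt0Pr => e e0; rewrite add0e.
have [j _ /(_ j (leqnn j)) je] := near_infty_natSinv_lt (PosNum e0).
apply: (le_trans (@unbounded_deficit_covering _ _ j.+1%:R^-1 _ _ _ _ _)) => //.
- rewrite preimage_bigcap; apply: eq_bigcapr => i _.
  by rewrite unbounded_deficit_invariant.
- by move=> x; apply.
apply: (@le_trans _ _ (j.+1%:R^-1%:E * 1)%E).
  by apply: lee_pmul => //; exact: probability_le1.
by rewrite mule1 lee_fin ltW.
Qed.

(** An unbounded deficit of visits to the complement of F m, at rate c, means
    that F m is visited with upper frequency at least 1 - c.  The covering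
    inequality for this event D gives P(D) <= P(F m) + c P(D), that is
    P(D) <= P(F m) / (1 - c). *)
Lemma frequent_visits_null (F : nat -> set T) (c : R) :
  (forall m, measurable (F m)) -> 0 <= c < 1 -> P (F m) @[m --> \oo] --> 0%E ->
  P (\bigcap_m unbounded_deficit theta (~` F m) c) = 0%E.
Proof.
move=> mF /andP[c0 c1] F0; set D := fun m => unbounded_deficit theta (~` F m) c.
have mD m : measurable (D m).
  by apply: measurable_unbounded_deficit; exact: measurableC.
have mE : measurable (\bigcap_m D m) by exact: bigcapT_measurable.
have fE A : measurable A -> P A = (fine (P A))%:E.
  by move=> mA; rewrite fineK// fin_num_measure.
have DF m : (1 - c) * fine (P (\bigcap_m D m)) <= fine (P (F m)).
  have ED : fine (P (\bigcap_m D m)) <= fine (P (D m)).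
    rewrite -lee_fin -!fE//; apply: le_measure; rewrite ?inE//.
    by move=> x; apply.
  have : (P (D m) <= P (F m) + c%:E * P (D m))%E.
    rewrite -{1}(setIT (D m)) -(setUv (F m)) setIUr.
    apply: (le_trans (measureU2 _ _ _)); try exact: measurableI.
      by apply: measurableI => //; exact: measurableC.
    apply: leeD; first by apply: le_measure; rewrite ?inE//; exact: measurableI.
    apply: unbounded_deficit_covering => //; first exact: measurableC.
    exact: unbounded_deficit_invariant.
  rewrite (fE (D m))// (fE (F m))// -EFinM -EFinD lee_fin; nra.
have F0' : fine (P (F m)) @[m --> \oo] --> (0 : R) by exact: fine_cvg.
rewrite fE//; congr EFin; apply/eqP; rewrite eq_le fine_ge0// andbT.
have c1' : 0 < 1 - c by rewrite subr_gt0.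
rewrite -(ler_pM2l c1') mulr0.
apply: (cvgr_to_ge F0').
by near=> m; exact: DF.
Unshelve. all: by end_near. Qed.

End deficit.

(** * The sequence space and the law of a stationary process *)

(** Its measurable sets are, by definition, those of [borel_RN R]. *)
Definition seqspace (R : realType) :=
  g_sigma_algebraType [set U : set {ptws nat -> R} | open U].

Definition box (R : realType) (e : R) (s : seq R) : set (nat -> R) :=
  [set y | forall i, (i < size s)%N -> `|nth 0 s i - y i| < e].

(** Otherwise a sequence of points y_n, taken in the n-th box around x but
    outside U, would converge to x pointwise. *)
Lemma box_nbhs (R : realType) (U : set {ptws nat -> R}) (x : nat -> R) :
  open U -> U x -> exists n, box n.+1%:R^-1 (mkseq x n) `<=` U.
Proof.
move=> oU Ux; apply/not_existsP => nU.
have /choice[y yP] : forall n, exists y : nat -> R, box n.+1%:R^-1 (mkseq x n) y /\ ~ U y.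
  by move=> n; have /existsNP[y /not_implyP[? ?]] := nU n; exists y.
have yx : {ptws, y @ \oo --> (x : {ptws nat -> R})}.
  apply/pointwise_cvgP => i.
  suff : y n i @[n --> \oo] --> x i by [].
  apply/cvgrPdist_lt => e e0.
  near=> n.
  have := (yP n).1 i; rewrite size_mkseq nth_mkseq; last by near: n; exact: nbhs_infty_gt.
  move=> /(_ _) H; apply: lt_le_trans (H _) _; first by near: n; exact: nbhs_infty_gt.
  by apply: ltW; near: n; exact: (near_infty_natSinv_lt (PosNum e0)).
have : \forall n \near \oo, U (y n).
  by apply: yx; apply: open_nbhs_nbhs.
by move=> [n _ /(_ n (leqnn n))]; exact: (yP n).2.
Unshelve. all: by end_near. Qed.

(** Half the width of the box of [box_nbhs] with as many coordinates, so that a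
    box whose rational centre is close to x stays inside the one around x. *)
Definition qbox (R : realType) (s : seq rat) : set (nat -> R) :=
  box (2 * (size s).+1%:R)^-1 (map ratr s).

(** R^N is second countable, which is why the Borel sets of the product
    topology are generated by events on single coordinates. *)
Lemma open_qbox (R : realType) (U : set {ptws nat -> R}) :
  open U -> U = \bigcup_s (if `[< @qbox R s `<=` U >] then @qbox R s else set0).
Proof.
move=> oU; apply/seteqP; split => [x Ux|x [s _]]; last first.
  by case: asboolP => // sU /sU.
have [n nU] := box_nbhs oU Ux.
have d0 : 0 < (2 * n.+1%:R : R)^-1 by rewrite invr_gt0.
have /choice[q qP] : forall i, exists q : rat, `|ratr q - x i| < (2 * n.+1%:R)^-1.
  move=> i; have [|q] :=
      @rat_in_itvoo R (x i - (2 * n.+1%:R)^-1) (x i + (2 * n.+1%:R)^-1).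
    by rewrite ltrBlDr -addrA ltrDl addr_gt0.
  rewrite in_itv/= => /andP[q1 q2]; exists q; rewrite ltr_norml.
  by apply/andP; split; [rewrite ltrBrDl|rewrite ltrBlDl].
exists (mkseq q n) => //; case: asboolP => [_|[]].
  move=> i; rewrite !size_map size_iota => ni.
  by rewrite (nth_map 0) ?size_mkseq// nth_mkseq.
move=> y yq; apply: nU => i; rewrite size_mkseq => ni; rewrite nth_mkseq//.
have := yq i; rewrite !size_map size_iota (nth_map 0) ?size_mkseq// nth_mkseq//.
move=> /(_ ni) {}yq.
have := qP i; rewrite distrC => {}qP.
have -> : x i - y i = (x i - ratr (q i)) + (ratr (q i) - y i) by ring.
have -> : n.+1%:R^-1 = (2 * n.+1%:R)^-1 + (2 * n.+1%:R)^-1 :> R.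
  by field.
by apply: le_lt_trans (ler_normD _ _) _; exact: ltrD.
Qed.

Lemma measurable_fun_seqspace d (T : measurableType d) (R : realType)
    (f : T -> seqspace R) :
  (forall i, measurable_fun setT (fun w => f w i)) -> measurable_fun setT f.
Proof.
move=> mf; apply: (@measurability _ _ T (seqspace R) setT f
  [set U : set {ptws nat -> R} | open U]) => //.
move=> _ [U oU <-]; rewrite setTI (open_qbox oU) preimage_bigcup.
apply: countable_bigcupT_measurable => [|s]; first exact: countableP.
case: asboolP => _; last by rewrite preimage_set0.
rewrite (_ : _ @^-1` _ = \bigcap_(i in [set i | (i < size s)%N])
  ((fun w => f w i) @^-1` [set r | `|ratr s`_i - r| < (2 * (size s).+1%:R)^-1])).
  apply: bigcap_measurableType => i _; rewrite -[X in measurable X]setTI.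
  by apply: mf => //; exact: (measurable_ball (ratr s`_i)).
apply/seteqP; split => w fw i /= si.
  by have := fw i; rewrite size_map => /(_ si); rewrite (nth_map 0).
by move: si; rewrite size_map => si; have := fw i si; rewrite (nth_map 0).
Qed.

Lemma measurable_coord (R : realType) i :
  measurable_fun [set: seqspace R] (fun x => x i : R).
Proof.
apply: (measurability _ (RGenOpens.measurableE R)) => _ [_ [a [b ->]] <-].
rewrite setTI; apply: sub_sigma_algebra.
apply: (@open_comp {ptws nat -> R} R (fun x => x i)); last exact: itv_open.
move=> x _; apply: (@proj_continuous nat (fun=> R) i).
Qed.

Definition rectangle (R : realType) : set (set (nat -> R)) :=
  [set C | exists n (A : nat -> set R), (forall i, measurable (A i)) /\
     C = [set x | forall i, (i < n)%N -> A i (x i)]].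

Lemma setI_rectangle (R : realType) : setI_closed (@rectangle R).
Proof.
move=> _ _ [n [A [mA ->]]] [m [B [mB ->]]].
pose tr k (C : nat -> set R) i := if (i < k)%N then C i else setT.
exists (maxn n m), (fun i => tr n A i `&` tr m B i); split.
  by move=> i; apply: measurableI; rewrite /tr; case: ifP.
apply/seteqP; split => [x [Ax Bx] i _|x ABx].
  by split; rewrite /tr; case: ifP => //; [exact: Ax|exact: Bx].
by split=> i im; have := ABx i; rewrite leq_max im ?orbT => /(_ isT)[];
   rewrite /tr im.
Qed.

Lemma measurable_rectangle (R : realType) : @rectangle R `<=` @borel_RN R.
Proof.
move=> _ [n [A [mA ->]]].
rewrite (_ : mkset _ = \bigcap_(i in [set i | (i < n)%N])
  ((fun x : seqspace R => x i) @^-1` A i)).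
  apply: (@bigcap_measurableType _ (seqspace R)) => i _.
  by rewrite -[X in measurable X]setTI; exact: measurable_coord.
by apply/seteqP; split.
Qed.

(** For the hard inclusion, [measurable_fun_seqspace] is applied to the identity
    map from R^N with the sigma-algebra of the rectangles. *)
Lemma borel_RN_rectangle (R : realType) : @borel_RN R = <<s @rectangle R >>.
Proof.
apply/seteqP; split => B mB; last first.
  apply: smallest_sub mB; last exact: measurable_rectangle.
  exact: (@sigma_algebra_measurable _ (seqspace R)).
pose T := g_sigma_algebraType (@rectangle R).
have : measurable_fun [set: T] (id : T -> seqspace R).
  apply: measurable_fun_seqspace => i _ A mA; rewrite setTI.
  apply: sub_sigma_algebra; exists i.+1, (fun j => if j == i then A else setT).
  split; first by move=> j; case: ifP.
  apply/seteqP; split => x /=.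
    by move=> Ax j _; case: eqP => // ->.
  by move=> /(_ i (ltnSn i)); rewrite eqxx.
by move=> /(_ measurableT B mB); rewrite setTI.
Qed.

Section law.
Context d (T : measurableType d) (R : realType) (P : probability T R).
Variable X : nat -> {RV P >-> R}.

Definition path_from (h : nat) (w : T) : seqspace R := fun j => X (h + j)%N w.

Lemma measurable_path_from h : measurable_fun setT (path_from h).
Proof. by apply: measurable_fun_seqspace => i; exact: measurable_funPT. Qed.

HB.instance Definition _ h :=
  isMeasurableFun.Build _ _ _ _ (path_from h) (measurable_path_from h).

Definition path_law h : probability (seqspace R) R := distribution P (path_from h).

Hypothesis stationary : strictly_stationary X.

(** Strict stationarity concerns finitely many coordinates at a time; the
    rectangles form a pi-system that generates the Borel sets. *)
Lemma path_law_stationary h (B : set (seqspace R)) :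
  measurable B -> path_law h B = path_law 0 B.
Proof.
apply: (@measure_unique _ R (seqspace R) (@rectangle R) (fun=> setT)
  (borel_RN_rectangle R) (@setI_rectangle R) _ _ (path_law h) (path_law 0)).
- by move=> _; exists 0%N, (fun=> setT); split=> //; apply/seteqP; split.
- by rewrite bigcup_const.
- move=> _ [n [A [mA ->]]].
  have mC : measurable [set t : n.-tuple R | forall i : 'I_n, A i (tnth t i)].
    rewrite (_ : mkset _ = \bigcap_(i : 'I_n) ((fun t => tnth t i) @^-1` A i)).
      apply: fin_bigcap_measurable => // i _.
      by rewrite -[X in measurable X]setTI; exact: measurable_tnth.
    by apply/seteqP; split => t At i; [move=> _; exact: At|exact: (At i I)].
  have /= H := stationary h mC.
  rewrite /path_law /distribution /pushforward/=.
  have E k : path_from k @^-1` [set x | forall i, (i < n)%N -> A i (x i)] =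
      [set w | forall i : 'I_n, A i (tnth [tuple X (k + j)%N w | j < n] i)].
    apply/seteqP; split => w Aw i; first by rewrite tnth_mktuple; exact: Aw.
    by move=> ni; have := Aw (Ordinal ni); rewrite tnth_mktuple.
  by rewrite !E H; congr (P _).
- by move=> _; apply: le_lt_trans (probability_le1 _ _) (ltry _).
Qed.

End law.

Definition shift (R : realType) (x : seqspace R) : seqspace R := fun i => x i.+1.

Lemma measurable_shift (R : realType) : measurable_fun setT (@shift R).
Proof. by apply: measurable_fun_seqspace => i; exact: measurable_coord. Qed.

Lemma iter_shift (R : realType) n (x : seqspace R) i :
  iter n (@shift R) x i = x (n + i)%N.
Proof. by elim: n i => // n IH i; rewrite iterS /shift IH addnS. Qed.

Lemma shift_preserving d (T : measurableType d) (R : realType) (P : probability T R)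
  (X : nat -> {RV P >-> R}) : strictly_stationary X ->
  forall B, measurable B -> path_law X 0 (@shift R @^-1` B) = path_law X 0 B.
Proof. by move=> sX B mB; rewrite -[RHS](path_law_stationary sX 1). Qed.

(** * Bounds for one path *)

Definition exceedances (R : realType) (x : nat -> R) (M : R) (n : nat) : nat :=
  \sum_(i < n) (M < x i)%R.

(** If the k-th smallest value were at most M, so would be the k smallest ones,
    leaving at most n - k exceedances. *)
Lemma order_stat_gt (R : realType) (x : nat -> R) (M : R) (k n : nat) :
  (1 <= k <= n)%N -> (n - k < exceedances x M n)%N -> M < order_stat x k n.
Proof.
move=> kn nk; rewrite ltNge; apply/negP => osM.
set s := sort <=%R [seq x i | i <- iota 0 n].
have ss : size s = n by rewrite size_sort size_map size_iota.
have : (k <= count (<= M) s)%N.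
  rewrite -{1}(_ : size (take k s) = k); last by rewrite size_takel// ss; lia.
  rewrite -(cat_take_drop k s) count_cat.
  rewrite (_ : count _ (take k s) = size (take k s)) ?size_cat; last first.
    apply/eqP; rewrite -all_count; apply/(all_nthP 0) => i.
    rewrite size_takel ?ss => [ik|]; last lia.
     rewrite nth_take; last lia.
    apply: le_trans osM; apply: le_sorted_leq_nth; rewrite ?inE ?ss; try lia.
    exact: sort_le_sorted.
  by rewrite cat_take_drop leq_addr.
rewrite count_sort => kM.
have := count_predC (<= M) [seq x i | i <- iota 0 n].
rewrite size_map size_iota.
have -> : count (predC (<= M)) [seq x i | i <- iota 0 n] = exceedances x M n.
  rewrite /exceedances count_map -sum1_count big_mkcond/=.
  rewrite -{1}(subn0 n) big_mkord; apply: eq_bigr => i _ /=.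
  by rewrite -ltNge; case: ifP.
lia.
Qed.

Lemma near_sum_bound (R : realType) (x : nat -> R) (m a : R) (k n : nat) :
  0 <= m -> 0 < a -> m + a <= order_stat x k n ->
  0 <= near_sum x k n a <= (exceedances x m n)%:R * order_stat x k n.
Proof.
move=> m0 a0 ma; rewrite /near_sum /exceedances; set q := order_stat x k n in ma *.
apply/andP; split.
  apply: sumr_ge0 => i /andP[qi _]; lra.
rewrite natr_sum mulr_suml big_mkcond/=; apply: ler_sum => i _.
case: ifPn => [/andP[qi iq]|_].
  have -> : m < x i by lra.
  by rewrite mul1r ltW.
rewrite mulr_ge0//; lra.
Qed.

(** Every level is exceeded with positive lower frequency; the constant K
    absorbs the first terms. *)
Definition exceeds_often (R : realType) (x : nat -> R) : Prop :=
  forall M : nat, exists j K : nat, forall n,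
    n%:R / j.+1%:R < (exceedances x M%:R n)%:R + K%:R :> R.

(** The upper frequency of exceedances of M tends to 0 as M grows. *)
Definition exceeds_rarely (R : realType) (x : nat -> R) : Prop :=
  forall j : nat, exists M K : nat, forall n,
    (exceedances x M%:R n)%:R < n%:R / j.+1%:R + K%:R :> R.

Section near_maximum.
Context (R : realType) (x : nat -> R) (a : R) (k : nat -> nat).
Hypothesis a0 : 0 < a.
Hypothesis kn : forall n : nat, (1 <= n)%N -> (1 <= k n <= n)%N.
Hypothesis kcvg : (k n)%:R / n%:R @[n --> \oo] --> (1 : R).

(** Eventually n - k n is smaller than the number of exceedances, which grows
    linearly in n. *)
Lemma order_stat_cvgy (M : R) : exceeds_often x ->
  \forall n \near \oo, M < order_stat x (k n) n.
Proof.
move=> xo; have [j [K jK]] := xo (Num.bound `|M|).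
have MB : M <= (Num.bound `|M|)%:R.
  by apply: (le_trans (ler_norm _)); rewrite ltW// archi_boundP.
have e0 : 0 < (2 * j.+1%:R : R)^-1 by rewrite invr_gt0.
have /cvgrPdist_lt/(_ _ e0) kj := kcvg.
near=> n.
have n0 : (0 < n)%N by near: n; exact: nbhs_infty_gt.
have n0' : 0 < n%:R :> R by rewrite ltr0n.
apply: (le_lt_trans MB); apply: order_stat_gt; first exact: kn.
have kjn : `|1 - (k n)%:R / n%:R| < (2 * j.+1%:R : R)^-1 by near: n.
have Kn : K%:R < (2 * j.+1%:R)^-1 * n%:R :> R.
  rewrite -ltr_pdivrMl//; near: n; exact: nbhs_infty_gtr.
rewrite -(ltr_nat R) natrB; last by have /andP[] := kn n0.
have {}kjn : n%:R - (k n)%:R < (2 * j.+1%:R)^-1 * n%:R :> R.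
  have -> : n%:R - (k n)%:R = (1 - (k n)%:R / n%:R) * n%:R :> R.
    by rewrite mulrBl mul1r divfK// gt_eqF.
  by rewrite ltr_pM2r//; apply: le_lt_trans kjn; exact: ler_norm.
have := jK n.
have -> : n%:R / j.+1%:R = (2 * j.+1%:R)^-1 * n%:R + (2 * j.+1%:R)^-1 * n%:R :> R.
  by field.
move: (_^-1 * n%:R) Kn kjn => u; lra.
Unshelve. all: by end_near. Qed.

Lemma near_sum_cvg0 : exceeds_often x -> exceeds_rarely x ->
  near_sum x (k n) n a / (n%:R * order_stat x (k n) n) @[n --> \oo] --> (0 : R).
Proof.
move=> xo xr; apply/cvgrPdist_lt => e e0.
have e20 : 0 < e / 2 by rewrite divr_gt0.
have [j _ /(_ j (leqnn j))/= je] := near_infty_natSinv_lt (PosNum e20).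
have [M [K MK]] := xr j.
near=> n.
have n0 : 0 < n%:R :> R by rewrite ltr0n; near: n; exact: nbhs_infty_gt.
have os : M%:R + a < order_stat x (k n) n.
  near: n; exact: order_stat_cvgy.
have os0 : 0 < order_stat x (k n) n by apply: le_lt_trans os; rewrite addr_ge0 // ltW.
have /andP[s0 sM] := near_sum_bound (ler0n R M) a0 (ltW os).
rewrite sub0r normrN ger0_norm; last by rewrite divr_ge0// mulr_ge0// ltW.
have Kn : K%:R < e / 2 * n%:R :> R.
  rewrite -ltr_pdivrMl//; near: n; exact: nbhs_infty_gtr.
rewrite ltr_pdivrMr; last exact: mulr_gt0.
apply: (le_lt_trans sM); rewrite mulrA ltr_pM2r//; apply: (lt_trans (MK n)).
have : n%:R / j.+1%:R < n%:R * (e / 2) by rewrite ltr_pM2l.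
move: (j.+1%:R^-1) => y; lra.
Unshelve. all: by end_near. Qed.

Lemma near_sum_random_index_cvg0 (N : R -> nat) (c : R -> R) (z : R) :
  (forall t : R, 0 <= t -> 0 < c t) -> c t @[t --> +oo] --> +oo -> 0 < z ->
  (N t)%:R / c t @[t --> +oo] --> z ->
  near_sum x (k n) n a / (n%:R * order_stat x (k n) n) @[n --> \oo] --> (0 : R) ->
  near_sum x (k (N t)) (N t) a / (c t * order_stat x (k (N t)) (N t))
    @[t --> +oo] --> (0 : R).
Proof.
move=> c0 coo z0 Nz s0.
have Noo : N t @[t --> +oo] --> \oo.
  apply/cvgnyPgt => A.
  near=> t.
  have ct : 0 < c t by apply: c0; near: t; exact: nbhs_pinfty_ge.
  have : z / 2 < (N t)%:R / c t.
    by near: t; apply: (cvgr_gt z) => //; rewrite ltr_pdivrMr// ltr_pMr// ltr1n.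
  rewrite ltr_pdivlMr// => zN; rewrite -(ltr_nat R); apply: le_lt_trans zN.
  rewrite -ler_pdivrMl ?divr_gt0//; near: t.
  by move/cvgryPge : coo; apply.
have -> : (fun t => near_sum x (k (N t)) (N t) a / (c t * order_stat x (k (N t)) (N t)))
  = (fun t => ((N t)%:R / c t) *
      (near_sum x (k (N t)) (N t) a / ((N t)%:R * order_stat x (k (N t)) (N t)))).
  apply/funext => t.
  (* when N t = 0 both sides vanish, the sum being empty *)
  have [->|N0] := posnP (N t).
    by rewrite /near_sum big_ord0 !mul0r.
  have nN : (N t)%:R != 0 :> R by rewrite pnatr_eq0 -lt0n.
  rewrite !invfM; move: (near_sum _ _ _ _) (c t) (order_stat _ _ _) => s u q.
  have -> : (N t)%:R * u^-1 * (s * ((N t)%:R^-1 * q^-1)) =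
      ((N t)%:R / (N t)%:R) * (s * (u^-1 * q^-1)) by ring.
  by rewrite divff// mul1r.
rewrite -(mulr0 z); apply: cvgM => //.
exact: (cvg_comp _ _ Noo s0).
Unshelve. all: by end_near. Qed.

End near_maximum.

(** * Exceedances of a stationary process *)

Definition above (R : realType) (M : R) : set (seqspace R) := [set x | M < x 0%N].

Lemma measurable_above (R : realType) (M : R) : measurable (above M).
Proof.
rewrite (_ : above M = (fun x : seqspace R => x 0%N) @^-1` `]M, +oo[%classic).
  by rewrite -[X in measurable X]setTI; apply: measurable_coord.
by apply/seteqP; split => x; rewrite /= in_itv/= andbT.
Qed.

Lemma visits_above (R : realType) (M : R) n (x : seqspace R) :
  visits R (@shift R) (above M) n x = (exceedances x M n)%:R.
Proof.
rewrite /visits /exceedances natr_sum; apply: eq_bigr => i _.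
rewrite indicE; congr (nat_of_bool _)%:R.
have -> : (M < x i) = (M < iter i (@shift R) x 0%N) by rewrite iter_shift addn0.
by apply/idP/idP => [/set_mem|?]; [|rewrite inE].
Qed.

Lemma visits_not_above (R : realType) (M : R) n (x : seqspace R) :
  visits R (@shift R) (~` above M) n x = n%:R - (exceedances x M n)%:R.
Proof.
apply/eqP; rewrite eq_sym subr_eq -visits_above /visits -big_split/=.
rewrite (eq_bigr (fun=> 1)) ?sumr_const ?card_ord// => i _.
by rewrite !indicE in_setC -natrD; case: (_ \in _).
Qed.

Section stationary.
Context d (T : measurableType d) (R : realType) (P : probability T R).
Variable X : nat -> {RV P >-> R}.
Hypothesis sX : strictly_stationary X.

Let mu := path_law X 0.

Lemma ae_path (B : set (seqspace R)) : measurable B -> mu B = 0%E ->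
  {ae P, forall w, ~ B (X ^~ w)}.
Proof.
move=> mB B0; exists (path_from X 0 @^-1` B); split => //.
  by rewrite -[X in measurable X]setTI; exact: measurable_path_from.
by move=> w /= /contrapT.
Qed.

Lemma above_cvg0 : mu (above M%:R) @[M --> \oo] --> 0%E.
Proof.
have -> : 0%E = mu (\bigcap_M above M%:R).
  rewrite -[LHS](measure0 mu); congr (mu _); apply/esym/seteqP; split=> // x xM.
  have := xM (Num.bound `|x 0%N|) I; rewrite /above/= ltNge.
  by rewrite (le_trans (ler_norm _))// ltW// archi_boundP.
apply: nonincreasing_cvg_mu.
- apply: le_lt_trans (probability_le1 mu _) (ltry _); exact: measurable_above.
- by move=> M; exact: measurable_above.
- by apply: bigcapT_measurable => M; exact: measurable_above.
- move=> M N MN; apply/subsetPset => x; rewrite /above/=.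
  by apply: le_lt_trans; rewrite ler_nat.
Qed.

(** For F m = {x | m < x 0} and c = 1 - 1 / (j + 1), the complement of the
    event of [frequent_visits_null] is a bound by 1 / (j + 1) on the upper
    frequency of exceedances of some level. *)
Lemma ae_exceeds_rarely : {ae P, forall w, exceeds_rarely (X ^~ w)}.
Proof.
pose c j : R := 1 - j.+1%:R^-1.
have c01 j : 0 <= c j < 1.
  by rewrite subr_ge0 invf_le1// ler1n /= ltrBlDr ltrDl invr_gt0.
pose B j := \bigcap_M unbounded_deficit (@shift R) (~` above (M%:R : R)) (c j).
have mB j : measurable (B j).
  apply: bigcapT_measurable => M; apply: measurable_unbounded_deficit.
    exact: measurable_shift.
  by apply: measurableC; exact: measurable_above.
have : {ae P, forall w, forall j, ~ B j (X ^~ w)}.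
  apply: ae_foralln => j; apply: ae_path => //.
  apply: frequent_visits_null => //.
  - exact: measurable_shift.
  - exact: shift_preserving.
  - by move=> M; exact: measurable_above.
  - exact: above_cvg0.
apply: filterS => w Bw j; have /existsNP[M /not_implyP[_ /existsNP[K xK]]] := Bw j.
exists M, K => n; rewrite ltNge; apply/negP => xn; apply: xK; exists n.
rewrite visits_not_above /c mulrBl mul1r [_^-1 * _]mulrC; move: (_ / _) xn => u; lra.
Qed.

(** This makes the probabilities in the defining property of a conditional
    probability given the invariant sigma-field those of genuine events. *)
Lemma invariant_set_measurable (A : set T) :
  invariant_sigma_field X A -> measurable A.
Proof.
move=> [B mB /(_ 0%N) ->].
by have := measurable_path_from X 0 measurableT mB; rewrite setTI.
Qed.

Lemma invariant_sigma_fieldC (A : set T) :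
  invariant_sigma_field X A -> invariant_sigma_field X (~` A).
Proof.
move=> [B mB AB]; exists (~` B) => [|i]; last by rewrite (AB i).
exact: (@measurableC _ (seqspace R)).
Qed.

Lemma invariant_sigma_fieldT : invariant_sigma_field X setT.
Proof.
by exists setT => //; exact: (@measurableT _ (seqspace R)).
Qed.

(** Let Q be M on A and +oo elsewhere.  It is measurable with respect to the
    invariant sigma-field and X 0 <= Q almost surely, so +oo = gamma <= Q
    almost surely, which is impossible on A. *)
Lemma bounded_invariant_null (gamma : T -> \bar R) (A : set T) (M : R) :
  is_cond_right_endpoint P (X 0%N) (invariant_sigma_field X) gamma ->
  {ae P, forall w, gamma w = +oo%E} ->
  invariant_sigma_field X A -> P (A `&` [set w | M < X 0%N w]) = 0%E ->
  {ae P, forall w, ~ A w}.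
Proof.
move=> [_ _ gmin] goo GA AM0.
pose Q w : \bar R := if `[< A w >] then M%:E else +oo%E.
have GT := invariant_sigma_fieldT.
have G0 : invariant_sigma_field X set0.
  by rewrite -setCT; exact: invariant_sigma_fieldC.
have mA := invariant_set_measurable GA.
have mM : measurable [set w | M < X 0%N w].
  rewrite (_ : mkset _ = X 0%N @^-1` `]M, +oo[%classic).
    by rewrite -[X in measurable X]setTI; exact: measurable_funPT.
  by apply/seteqP; split => w; rewrite /= in_itv/= andbT.
have GQ : measurable_wrt (invariant_sigma_field X) Q.
  move=> B _; rewrite /Q.
  have [BM|BM] := pselect (B M%:E); have [Boo|Boo] := pselect (B +oo%E).
  - rewrite (_ : _ @^-1` _ = setT)//; apply/seteqP; split => // w _ /=.
    by case: ifP.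
  - rewrite (_ : _ @^-1` _ = A)//; apply/seteqP; split => w /=; case: asboolP => //.
  - rewrite (_ : _ @^-1` _ = ~` A); first exact: invariant_sigma_fieldC.
    by apply/seteqP; split => w /=; case: asboolP.
  - rewrite (_ : _ @^-1` _ = set0)//; apply/seteqP; split => w //=.
    by case: ifP.
have Q1 : cond_probability_eq1 P (invariant_sigma_field X)
    [set w | ((X 0%N w)%:E <= Q w)%E].
  (* the event has probability 1, so the constant 1 is a version *)
  exists (fun=> 1); last by apply: aeW.
  split.
  - move=> B _; have [B1|B1] := pselect (B 1).
      by rewrite (_ : _ @^-1` _ = setT)//; apply/seteqP; split.
    by rewrite (_ : _ @^-1` _ = set0)//; apply/seteqP; split.
  - exact: finite_measure_integrable_cst.
  - move=> C /invariant_set_measurable mC; rewrite integral_cst// mul1e.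
    have XQ : [set w | ((X 0%N w)%:E <= Q w)%E] = ~` (A `&` [set w | M < X 0%N w]).
      apply/seteqP; split => w; rewrite /Q /=; case: asboolP => Aw.
      - by rewrite lee_fin => XM [_]; rewrite ltNge XM.
      - by move=> _ [].
      - by rewrite lee_fin leNgt => nAM; apply/negP => XM; apply: nAM.
      - by move=> _; exact: leey.
    rewrite XQ -setDE measureD//; last 2 first.
    - exact: measurableI.
    - exact: le_lt_trans (probability_le1 _ _) (ltry _).
    rewrite [X in (_ = _ - X)%E](_ : _ = 0%E) ?sube0//.
    apply/eqP; rewrite eq_le measure_ge0 andbT -AM0.
    have mAM := measurableI _ _ mA mM.
    by apply: le_measure; rewrite ?inE//; exact: measurableI.
have := gmin Q GQ Q1; apply: filterS2 goo => w -> /[swap] Aw.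
by rewrite /Q; case: asboolP.
Qed.

(** The invariant event on which M is exceeded with zero lower frequency meets
    {X 0 > M} in a null set, hence is null by [bounded_invariant_null]. *)
Lemma ae_exceeds_often (gamma : T -> \bar R) :
  is_cond_right_endpoint P (X 0%N) (invariant_sigma_field X) gamma ->
  {ae P, forall w, gamma w = +oo%E} ->
  {ae P, forall w, exceeds_often (X ^~ w)}.
Proof.
move=> endpoint goo.
pose B (M : nat) := rare_visits R (@shift R) (above M%:R).
have mB M : measurable (B M).
  apply: bigcapT_measurable => j; apply: measurable_unbounded_deficit.
    exact: measurable_shift.
  exact: measurable_above.
have shiftB M : @shift R @^-1` B M = B M.
  rewrite preimage_bigcap; apply: eq_bigcapr => j _.
  by rewrite unbounded_deficit_invariant.
have : {ae P, forall w, forall M, ~ B M (X ^~ w)}.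
  apply: ae_foralln => M.
  apply: (@bounded_invariant_null gamma (path_from X 0 @^-1` B M) M%:R) => //.
    exists (B M); first exact: mB.
    move=> i; rewrite -[in LHS](iter_invariant i (shiftB M)).
    apply/seteqP; split => w; rewrite /preimage /=; congr (B M _);
      by apply/funext => j; rewrite iter_shift.
  rewrite -(rare_visits_null _ (shift_preserving sX) (measurable_above M%:R)) //.
  exact: measurable_shift.
apply: filterS => w Bw M; have /existsNP[j /not_implyP[_ /existsNP[K xK]]] := Bw M.
exists j, K => n; rewrite ltNge; apply/negP => xn; apply: xK; exists n.
by rewrite visits_above mulrC.
Qed.

End stationary.

Theorem theorem4p4 (d : measure_display) (T : measurableType d) (R : realType)
  (P : probability T R) (a : R) (k : nat -> nat) (X : nat -> {RV P >-> R})
  (gamma : T -> \bar R) :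
  0 < a ->
  (forall n : nat, (1 <= n)%N -> (1 <= k n <= n)%N) ->
  (k n)%:R / n%:R @[n --> \oo] --> (1 : R) ->
  strictly_stationary X ->
  is_cond_right_endpoint P (X 0%N) (invariant_sigma_field X) gamma ->
  {ae P, forall w, gamma w = +oo%E} ->
  {ae P, forall w,
    near_sum (X ^~ w) (k n) n a / (n%:R * order_stat (X ^~ w) (k n) n)
      @[n --> \oo] --> (0 : R)} /\
  (forall (N : R -> T -> nat) (Z : {RV P >-> R}) (c : R -> R),
    (forall t : R, 0 <= t -> measurable_fun setT (N t)) ->
    {ae P, forall w, 0 < Z w} ->
    (forall t : R, 0 <= t -> 0 < c t) ->
    c t @[t --> +oo] --> +oo ->
    {ae P, forall w, (N t w)%:R / c t @[t --> +oo] --> Z w} ->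
    {ae P, forall w,
      near_sum (X ^~ w) (k (N t w)) (N t w) a
        / (c t * order_stat (X ^~ w) (k (N t w)) (N t w))
        @[t --> +oo] --> (0 : R)}).
Proof.
move=> a0 kn kcvg sX endpoint goo.
have often := ae_exceeds_often sX endpoint goo.
have rarely := ae_exceeds_rarely sX.
have first : {ae P, forall w,
    near_sum (X ^~ w) (k n) n a / (n%:R * order_stat (X ^~ w) (k n) n)
      @[n --> \oo] --> (0 : R)}.
  by apply: filterS2 often rarely => w; exact: near_sum_cvg0.
split=> // N Z c _ Z0 c0 coo NZ.
apply: filterS3 first Z0 NZ => w Sw Zw Nw.
exact: near_sum_random_index_cvg0 Nw Sw.
Qed.
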